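(* Let $G$ be any graph with $N$ nodes and maximum node degree $\Delta$, and let $\ell_1,\ldots,\ell_d$ be positive integers with $\prod_{i=1}^d \ell_i\ge N$. Then $G$ can be embedded into the $d$-dimensional $\ell_1\times\cdots\times\ell_d$-grid with dilation at most $2\sum_{i=1}^d \ell_i$ and edge-congestion at most $2\lceil \Delta/2\rceil\cdot\max_{1\le i\le d}\ell_i$ (by a single embedding achieving both bounds).
   Context: Guest graphs are finite, simple and undirected. Write $[\ell]=\{1,\ldots,\ell\}$. The $d$-dimensional $\ell_1\times\cdots\times\ell_d$-grid is the graph with node set $\prod_{i=1}^d[\ell_i]$ in which two nodes are adjacent iff they differ in exactly one coordinate, and there by exactly $1$. An embedding of a graph $G$ into a graph $H$ is a pair $\langle\phi,\rho\rangle$ where $\phi:V(G)\to V(H)$ is injective and $\rho$ assigns to each edge $(u,v)$ of $G$ the edge set of a path in $H$ connecting $\phi(u)$ and $\phi(v)$. Its dilation is the maximum, over edges of $G$, of the number of edges of the assigned path. Its edge-congestion is the maximum, over edges $e'$ of $H$, of the number of edges of $G$ whose assigned path contains $e'$. *)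

(* Defs.v *)
From mathcomp Require Import all_boot.

Set Implicit Arguments.
Unset Strict Implicit.
Unset Printing Implicit Defensive.

(* Plain MathComp; graphs are finite, simple and undirected. *)
Record sgraph := SGraph {
  vertex :> finType;
  adj : rel vertex;
  adj_sym : symmetric adj;
  adj_irr : irreflexive adj }.

Definition edges (G : sgraph) : {set {set G}} :=
  [set [set p.1; p.2] | p : G * G & adj p.1 p.2].

Definition degree (G : sgraph) (v : G) : nat := #|[set w : G | adj v w]|.

Definition max_degree (G : sgraph) : nat := \max_(v : G) degree v.

Section Grid.
Variables (d : nat) (l : 'I_d -> nat).

(* Coordinates are 0-based: [l i] = {1, ..., l i} is rendered as 'I_(l i). *)
Definition grid_node : finType := {dffun forall i : 'I_d, 'I_(l i)}.

Definition grid_adj : rel grid_node := fun x y =>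
  [exists i : 'I_d,
    (((x i).+1 == y i :> nat) || ((y i).+1 == x i :> nat)) &&
    [forall j : 'I_d, (j != i) ==> (x j == y j)]].

Lemma grid_adj_sym : symmetric grid_adj.
Proof.
move=> x y; apply: eq_existsb => i; rewrite orbC; congr (_ && _).
by apply: eq_forallb => j; rewrite [x j == _]eq_sym.
Qed.

Lemma grid_adj_irr : irreflexive grid_adj.
Proof.
by move=> x; apply/existsP => -[i]; rewrite orbb gtn_eqF.
Qed.

Definition grid : sgraph := SGraph grid_adj_sym grid_adj_irr.
End Grid.

(* The edges of the walk visiting a and then the successive nodes of p. *)
Definition walk_edges (H : sgraph) (a : H) (p : seq H) : {set {set H}} :=
  [set [set z.1; z.2] | z in zip (a :: p) p].

(* F is the edge set of a path (no repeated node) of H connecting a and b. *)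
Definition path_edge_set (H : sgraph) (a b : H) (F : {set {set H}}) : Prop :=
  exists p : seq H,
    [/\ path (@adj H) a p, last a p = b, uniq (a :: p) & F = walk_edges a p].

(* route is total on sets of nodes, but only its values on edges G matter. *)
Record embedding (G H : sgraph) := Embedding {
  node_map : G -> H;
  route : {set G} -> {set {set H}};
  node_map_inj : injective node_map;
  routeP : forall u v : G, adj u v ->
    path_edge_set (node_map u) (node_map v) (route [set u; v]) }.

Definition dilation (G H : sgraph) (f : embedding G H) : nat :=
  \max_(e in edges G) #|route f e|.

Definition edge_congestion (G H : sgraph) (f : embedding G H) : nat :=
  \max_(e' in edges H) #|[set e in edges G | e' \in route f e]|.

(* Main.v *)
Require Import Defs.
From mathcomp Require Import all_boot.
From mathcomp Require Import zify.

(* Orient G so that all in- and out-degrees are at most k = ceil(Delta/2), and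
   place its nodes arbitrarily.  Each oriented edge is a packet travelling from
   x to y through an intermediate node c: coordinates 0, ..., d-1 are changed
   one at a time from those of x to those of c, and then, in reverse order, to
   those of y.  The coordinates of c are chosen one by one so that in every
   phase each grid node holds at most k packets: the packets are the edges of a
   bipartite multigraph between the lines in direction i occupied on the x-side
   and on the y-side, with degrees at most k * l i, and are coloured with l i
   colours so that each colour has degree at most k.  A line then carries at
   most k * l i packets per phase, and every grid edge lies on a single line,
   which is used in two phases only.  The colouring exists because two colour
   classes can be rebalanced by alternation along paths and even cycles; the
   same alternation gives the orientation. *)

Set Implicit Arguments.
Unset Strict Implicit.
Unset Printing Implicit Defensive.

(** * Signs reversed by two involutions *)

Section Alternating.
Variables (X : finType) (s t : X -> X).
Hypotheses (sK : involutive s) (tK : involutive t).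

(* [t \o s] has cycles permuted by [s]; without fixed points no cycle is mapped
   to itself, so one may pick a cycle out of each pair. *)
Lemma alternating_fixfree :
    (forall x, s x != x) -> (forall x, t x != x) ->
  exists f : X -> bool, forall x, f (s x) = ~~ f x /\ f (t x) = ~~ f x.
Proof.
move=> s_fixfree t_fixfree; pose q x := t (s x).
(* So [s] preserves no cycle of [q]: if n + 2 steps of [q] led from [x] to [s x], then n steps would
   lead from [q x] to [s (q x)], and so on down to a fixed point of [s] or [t]. *)
have iter_q n x : iter n q x != s x.
  have [m] := ubnP n; elim: m n x => // m IHm [|[|n]] x.
  - by rewrite eq_sym.
  - by rewrite /= /q t_fixfree.
  rewrite ltnS => /ltnW ltnm; apply: contra (IHm n (q x) ltnm) => /eqP Es.
  apply/eqP/(inv_inj sK); rewrite sK; apply: (inv_inj tK); rewrite [RHS]tK -Es.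
  by rewrite iterS iterSr.
have qI : injective q by move=> x y /(inv_inj tK)/(inv_inj sK).
have qsym := fconnect_sym qI.
have neq x : froot q x != froot q (s x).
  apply/eqP => /(rootP qsym)/iter_findex/eqP; exact/negP.
(* Of the two cycles through [x] and [s x], the one whose root has smaller rank gets [true]. *)
pose f x := enum_rank (froot q x) < enum_rank (froot q (s x)).
have fs x : f (s x) = ~~ f x.
  rewrite /f sK -leqNgt [RHS]leq_eqVlt.
  by rewrite (inj_eq val_inj) (inj_eq enum_rank_inj) eq_sym (negbTE (neq x)).
(* Since [q (s x) = t x], the points [t x] and [s x] share a cycle, so [t] changes [f] exactly as
   [s] does. *)
exists f => x; split=> //; rewrite -fs /f.
have q1 y : froot q (q y) = froot q y.
  by apply/esym/(rootP qsym)/fconnect1.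
have Et : q (s x) = t x by rewrite /q sK.
have Es : q (s (t x)) = x by rewrite /q sK tK.
by rewrite -Et q1 Et -(q1 (s (t x))) Es sK.
Qed.
End Alternating.

(* Two copies of [X], swapped at the fixed points, reduce to the previous case. *)
Lemma alternating (X : finType) (s t : X -> X) :
    involutive s -> involutive t ->
  exists f : X -> bool,
    (forall x, s x != x -> f (s x) = ~~ f x) /\
    (forall x, t x != x -> f (t x) = ~~ f x).
Proof.
pose dbl u (p : X * bool) := if u p.1 == p.1 then (p.1, ~~ p.2) else (u p.1, p.2).
have dblK u : involutive u -> involutive (dbl u).
  move=> uK [x b]; rewrite /dbl /=; case: (eqVneq (u x) x) => [Eu|Nu] /=.
    by rewrite Eu eqxx negbK.
  by rewrite uK eq_sym (negbTE Nu).
have dbl_fixfree u p : dbl u p != p.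
  case: p => x b; rewrite /dbl /=; case: (eqVneq (u x) x) => [Eu|Nu] /=.
    by rewrite xpair_eqE eqxx; case: b.
  by rewrite xpair_eqE (negbTE Nu).
move=> sK tK; have [f Hf] := alternating_fixfree (dblK _ sK) (dblK _ tK)
  (dbl_fixfree s) (dbl_fixfree t).
exists (fun x => f (x, false)); split=> x Nx; have [Hs Ht] := Hf (x, false).
  by rewrite -Hs /dbl /= (negbTE Nx).
by rewrite -Ht /dbl /= (negbTE Nx).
Qed.

(** * Halving all fibres of two maps at once *)

(** Positions 2j and 2j+1 in an enumeration of each fibre are swapped; only the last element of an
    odd fibre is left alone. *)
Lemma fiber_pairing (E S : finType) (g : E -> S) :
  exists s : E -> E, [/\ involutive s, forall e, g (s e) = g e &
    forall e e', g e = g e' -> s e = e -> s e' = e' -> e = e'].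
Proof.
pose L a := [seq x <- enum E | g x == a].
pose flip i := if odd i then i.-1 else i.+1.
have flipK i : flip (flip i) = i.
  by rewrite /flip; case: i => //= i; case Ei: (odd i); rewrite /= ?Ei.
have flip_neq i : flip i != i by rewrite /flip; case: ifP => //; lia.
have flip_leS i : flip i <= i.+1 by rewrite /flip; case: ifP; lia.
have memL e : e \in L (g e) by rewrite mem_filter eqxx mem_enum.
have uniqL a : uniq (L a) by rewrite filter_uniq ?enum_uniq.
(* The default [e] makes an element without partner a fixed point. *)
pose s e := nth e (L (g e)) (flip (index e (L (g e)))).
have gs e : g (s e) = g e.
  rewrite /s; case: (ltnP (flip (index e (L (g e)))) (size (L (g e)))) => lt_i.
    by have := mem_nth e lt_i; rewrite mem_filter => /andP[/eqP].
  by rewrite nth_default.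
have s_fix e : s e = e -> (index e (L (g e))).+1 = size (L (g e)).
  have := memL e; rewrite -index_mem => lt_e Ee.
  case: (ltnP (flip (index e (L (g e)))) (size (L (g e)))) => lt_i.
    have := index_uniq e lt_i (uniqL _); rewrite -/(s e) Ee.
    by move/esym/eqP; rewrite (negbTE (flip_neq _)).
  by apply/eqP; rewrite eqn_leq lt_e (leq_trans lt_i).
exists s; split=> // [e|e e' Eg Ee Ee'].
  case: (ltnP (flip (index e (L (g e)))) (size (L (g e)))) => lt_i; last first.
    by rewrite [s e]nth_default // /s nth_default.
  by rewrite {1}/s gs [index (s e) _]index_uniq // flipK nth_index.
have := s_fix _ Ee; rewrite Eg -(s_fix _ Ee') => -[Ei].
by rewrite -(nth_index e (memL e)) Eg Ei nth_index.
Qed.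

(** The map [s] injects the non-fixed elements of one colour into the other colour, and at most one
    element is fixed, so the two classes differ by at most one. *)
Lemma card_split (E : finType) (A : {set E}) (f : E -> bool) (s : E -> E) :
    injective s -> {in A, forall e, s e \in A} ->
    {in A, forall e, s e != e -> f (s e) = ~~ f e} ->
    {in A &, forall e e', s e = e -> s e' = e' -> e = e'} ->
  forall b, #|[set e in A | f e == b]| <= uphalf #|A|.
Proof.
move=> sI sA sf sfix b.
have -> : #|A| = #|[set e in A | f e == b]| + #|[set e in A | f e == ~~ b]|.
  rewrite -cardsUI [X in _ = _ + #|pred_of_set X|](_ : _ = set0); last first.
    by apply/setP => e; rewrite !inE; case: (e \in A); case: (f e); case: b.
  rewrite cards0 addn0; apply: eq_card => e; rewrite !inE.
  by case: (e \in A); case: (f e); case: b.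
suff: #|[set e in A | f e == b]| <= (#|[set e in A | f e == ~~ b]|).+1 by lia.
rewrite -(cardsID [set e | s e == e]) -add1n leq_add //.
  apply/card_le1_eqP => x y; rewrite !inE.
  by move=> /andP[/andP[xA _] /eqP sx] /andP[/andP[yA _] /eqP sy]; apply: sfix.
rewrite -(card_imset _ sI) subset_leq_card //; apply/subsetP => x /imsetP[e].
rewrite !inE => /and3P[Ne eA /eqP <-] ->.
by rewrite sA // sf ?eqxx.
Qed.

(** In the bipartite multigraph with edges [E] and ends [g], [h], the edges are paired off at each
    vertex, and [f] alternates along both pairings. *)
Lemma balanced_split (E S T : finType) (g : E -> S) (h : E -> T) :
  exists f : E -> bool,
    (forall a b, #|[set e in g @^-1: [set a] | f e == b]|
                  <= uphalf #|g @^-1: [set a]|) /\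
    (forall a b, #|[set e in h @^-1: [set a] | f e == b]|
                  <= uphalf #|h @^-1: [set a]|).
Proof.
have [s [sK gs sfix]] := fiber_pairing g.
have [t [tK ht tfix]] := fiber_pairing h.
have [f [fs ft]] := alternating sK tK.
exists f; split=> a b.
  apply: (card_split (s := s)) => [|e|e _|e e']; rewrite ?inE ?gs //.
  - exact: inv_inj.
  - exact: fs.
  by move=> /eqP ge /eqP ge'; apply: sfix; rewrite ge.
apply: (card_split (s := t)) => [|e|e _|e e']; rewrite ?inE ?ht //.
- exact: inv_inj.
- exact: ft.
by move=> /eqP ge /eqP ge'; apply: tfix; rewrite ge.
Qed.

(** The truncated excess over [k] is convex, so the most even split of [n] minimises the sum. *)
Lemma excess_le a b x y k n :
    x <= uphalf n -> y <= uphalf n -> n = a + b -> n = x + y ->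
  (x - k) + (y - k) <= (a - k) + (b - k).
Proof. lia. Qed.

Lemma excess_lt a b x y k n :
    x <= uphalf n -> y <= uphalf n -> n = a + b -> n = x + y ->
  k < a -> b < k -> (x - k) + (y - k) < (a - k) + (b - k).
Proof. lia. Qed.

(** * Colourings with bounded colour degrees *)

Section Colouring.
Variables (E V : finType) (inc : V -> {set E}).
Hypothesis inc_split : forall A : {set E}, exists f : E -> bool,
  forall v b, #|[set e in A :&: inc v | f e == b]| <= uphalf #|A :&: inc v|.

(* A colouring of minimal total excess over [k]: rebalancing an overfull colour
   with an underfull one would decrease it. *)
Lemma equitable_colouring k m : 0 < m -> (forall v, #|inc v| <= k * m) ->
  exists c : E -> 'I_m, forall v j, #|[set e in inc v | c e == j]| <= k.
Proof.
move=> m_gt0 inc_le.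
pose deg (c : E -> 'I_m) v j := #|[set e in inc v | c e == j]|.
pose excess (c : {ffun E -> 'I_m}) := \sum_v \sum_j (deg c v j - k).
have [c _ cmin] := arg_minnP excess (isT : xpredT [ffun=> Ordinal m_gt0]).
have deg_sum v : \sum_j deg c v j = #|inc v|.
  rewrite -sum1_card (partition_big c xpredT) //=; apply: eq_bigr => j _.
  by rewrite sum1_card; apply: eq_card => e; rewrite !inE.
exists c => v1 j1; rewrite leqNgt; apply/negP; rewrite -/(deg c v1 j1) => deg1.
(* Otherwise all colours have degree at least [k] at [v1], and [j1] has more, which exceeds the
   total [k * m]. *)
have /existsP[j2 deg2] : [exists j2, deg c v1 j2 < k].
  rewrite -[X in is_true X]negbK negb_exists; apply/negP => /forallP deg2; have := inc_le v1; rewrite -deg_sum leqNgt.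
  have -> : k * m = \sum_(j < m) k by rewrite sum_nat_const card_ord mulnC.
  rewrite (bigD1 j1) //= [ltnRHS](bigD1 j1) //=.
  by rewrite -addSn leq_add // leq_sum // => j _; rewrite leqNgt.
have N12 : j2 != j1 by apply: contraTneq deg2 => ->; rewrite -leqNgt ltnW.
pose A := [set e | (c e == j1) || (c e == j2)].
have [f Hf] := inc_split A.
pose c' : {ffun E -> 'I_m} :=
  [ffun e => if e \in A then if f e then j1 else j2 else c e].
have degD c0 v : \sum_j (deg c0 v j - k) = (deg c0 v j1 - k) + (deg c0 v j2 - k)
    + \sum_(j | (j != j1) && (j != j2)) (deg c0 v j - k).
  by rewrite (bigD1 j1) //= (bigD1 j2) //= addnA.
have degc' v j : j != j1 -> j != j2 -> deg c' v j = deg c v j.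
  move=> N1 N2; apply: eq_card => e; rewrite !inE ffunE inE.
  congr (_ && _); case: ifP => // /orP[]/eqP ->;
    by case: (f e); rewrite ![_ == j]eq_sym ?(negbTE N1) ?(negbTE N2).
have cA v : #|A :&: inc v| = deg c v j1 + deg c v j2.
  rewrite /deg -cardsUI [X in _ = _ + #|pred_of_set X|](_ : _ = set0); last first.
    apply/setP => e; rewrite !inE; case: eqP => [->|_]; rewrite ?andbF //.
    by rewrite eq_sym (negbTE N12) !andbF.
  rewrite cards0 addn0; apply: eq_card => e; rewrite !inE.
  by case: (e \in inc v); rewrite ?andbF ?andbT.
have cA' v : #|A :&: inc v| = deg c' v j1 + deg c' v j2.
  rewrite /deg -cardsUI [X in _ = _ + #|pred_of_set X|](_ : _ = set0); last first.
    apply/setP => e; rewrite !inE; case: eqP => [->|_]; rewrite ?andbF //.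
    by rewrite eq_sym (negbTE N12) !andbF.
  rewrite cards0 addn0; apply: eq_card => e; rewrite !inE ffunE !inE.
  case: (e \in inc v); rewrite ?andbF ?andbT //=.
  case: ifP => [_|/negP H]; first by case: (f e); rewrite !eqxx ?orbT.
  by apply/esym/negP.
have deg1' v : deg c' v j1 <= uphalf #|A :&: inc v|.
  apply: leq_trans (Hf v true); apply: subset_leq_card; apply/subsetP => e.
  rewrite !inE ffunE inE => /andP[->]; case: ifP => [_|/orP H /eqP E1]; last first.
    by case: H; left; rewrite E1.
  by case: (f e); rewrite //= (negbTE N12).
have deg2' v : deg c' v j2 <= uphalf #|A :&: inc v|.
  apply: leq_trans (Hf v false); apply: subset_leq_card; apply/subsetP => e.
  rewrite !inE ffunE inE => /andP[->]; case: ifP => [_|/orP H /eqP E1]; last first.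
    by case: H; right; rewrite E1.
  by case: (f e); rewrite //= eq_sym (negbTE N12).
have rest v : \sum_(j | (j != j1) && (j != j2)) (deg c' v j - k) =
    \sum_(j | (j != j1) && (j != j2)) (deg c v j - k).
  by apply: eq_bigr => j /andP[N1 N2]; rewrite degc'.
suff: excess c' < excess c by rewrite ltnNge cmin.
(* The excess drops strictly at [v1] and does not grow at any other vertex. *)
rewrite /excess (bigD1 v1) //= [ltnRHS](bigD1 v1) //= -addSn leq_add //.
  rewrite !degD rest.
  by rewrite ltn_add2r; apply: excess_lt (deg1' v1) (deg2' v1) (cA v1) (cA' v1) _ _.
apply: leq_sum => v _; rewrite !degD rest.
by rewrite leq_add2r; apply: excess_le (deg1' v) (deg2' v) (cA v) (cA' v).
Qed.
End Colouring.

Lemma bipartite_colouring (E S T : finType) (g : E -> S) (h : E -> T) k m :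
    0 < m -> (forall a, #|g @^-1: [set a]| <= k * m) ->
    (forall a, #|h @^-1: [set a]| <= k * m) ->
  exists c : E -> 'I_m,
    (forall a j, #|[set e | (g e == a) && (c e == j)]| <= k) /\
    (forall a j, #|[set e | (h e == a) && (c e == j)]| <= k).
Proof.
move=> m_gt0 g_le h_le.
pose inc (v : S + T) :=
  match v with inl a => g @^-1: [set a] | inr a => h @^-1: [set a] end.
have [||c Hc] := @equitable_colouring E _ inc _ k m m_gt0; last first.
- exists c; split=> a j; [have := Hc (inl a) j | have := Hc (inr a) j];
    by apply: leq_trans; rewrite subset_leq_card //; apply/subsetP => e; rewrite !inE.
- by case=> a; rewrite /inc.
(* Elements outside [A] are sent to [None], so the fibres over [Some a] see only [A]. *)
move=> A; pose rA U (q : E -> U) e := if e \in A then Some (q e) else None.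
have rAE (U : finType) (q : E -> U) a :
    rA U q @^-1: [set Some a] = A :&: q @^-1: [set a].
  by apply/setP => e; rewrite !inE /rA; case: (e \in A).
have [f [fg fh]] := balanced_split (rA _ g) (rA _ h).
by exists f => -[a|a] b; rewrite /= -rAE.
Qed.

(** * Balanced orientation of the guest graph *)

(** The ordered adjacent pairs are split so that both the two pairs on an edge and the pairs leaving
    a node are halved; those with [f] true are the arcs. *)
Lemma balanced_orientation (G : sgraph) : exists o : rel G,
  [/\ forall u v, adj u v -> o u v = ~~ o v u,
      forall u v, o u v -> adj u v,
      forall u, #|[set v | o u v]| <= uphalf (max_degree G) &
      forall v, #|[set u | o u v]| <= uphalf (max_degree G)].
Proof.
pose E := {p : G * G | adj p.1 p.2}.
pose g (e : E) := [set (val e).1; (val e).2]; pose h (e : E) := (val e).1.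
have [f [fg fh]] := balanced_split g h.
pose o : rel G := fun u v => [exists e : E, (val e == (u, v)) && f e].
have oE (e : E) : o (val e).1 (val e).2 = f e.
  apply/existsP/idP => [[e' /andP[/eqP]]|fe]; last first.
    by exists e; rewrite fe -surjective_pairing eqxx.
  by rewrite -surjective_pairing => /val_inj ->.
have o_adj u v : o u v -> adj u v.
  by case/existsP => e /andP[/eqP Ee _]; have := valP e; rewrite /= Ee.
have h_le u : #|h @^-1: [set u]| <= max_degree G.
  apply: leq_trans (leq_bigmax u); rewrite /degree.
  rewrite -(card_in_imset (f := fun e : E => (val e).2)); last first.
    move=> e1 e2; rewrite !inE /h => /eqP E1 /eqP E2 E3; apply: val_inj.
    by apply/eqP; rewrite -pair_eqE /= E1 E2 E3 !eqxx.
  apply/subset_leq_card/subsetP => w /imsetP[e]; rewrite !inE /h => /eqP <- ->.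
  exact: (valP e).
have o_asym u v : adj u v -> o u v = ~~ o v u.
  move=> uv; have vu : adj v u by rewrite adj_sym.
  pose e1 : E := exist _ (u, v) uv; pose e2 : E := exist _ (v, u) vu.
  rewrite (oE e1) (oE e2); suff: f e1 != f e2 by case: (f e1); case: (f e2).
  apply/negP => /eqP Ef.
  have N12 : e1 != e2.
    apply/eqP => /(congr1 (fun e : E => (val e).1)) /= Euv.
    by have := uv; rewrite Euv adj_irr.
  (* A fibre of [g] consists of the two pairs on one edge, hence holds at most [uphalf 2], that is
     1, of each colour. *)
  have : #|[set e1; e2]| <= uphalf 2.
    apply: leq_trans (leq_trans (fg (g e1) (f e1)) _).
      apply/subset_leq_card/subsetP => e; rewrite !inE.
      by case/orP => /eqP ->; rewrite ?Ef !eqxx ?andbT // /g /= setUC.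
    apply/uphalf_leq/(@leq_trans #|[set e1; e2]|); last by rewrite cards2; case: (_ == _).
    apply/subset_leq_card/subsetP => -[[a b] ab]; rewrite !inE /g /= => /eqP Eab.
    rewrite -!(inj_eq val_inj) /= !xpair_eqE.
    have := set21 a b; have := set22 a b; rewrite Eab !inE.
    move=> /orP[]/eqP Eb /orP[]/eqP Ea; move: ab; rewrite /= Ea Eb ?eqxx ?orbT //;
      by rewrite adj_irr.
  by rewrite cards2 N12.
exists o; split=> // u.
  apply: leq_trans (uphalf_leq (h_le u)); apply: leq_trans (fh u true).
  apply: leq_trans (leq_imset_card (fun e : E => (val e).2) _).
  apply/subset_leq_card/subsetP => w; rewrite inE => ouw.
  apply/imsetP; exists (exist _ (u, w) (o_adj _ _ ouw)) => //.
  by rewrite !inE /h /= eqxx -oE /= ouw.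
(* Reversing the arcs into [u] gives pairs that leave [u] and have [f] false. *)
apply: leq_trans (uphalf_leq (h_le u)); apply: leq_trans (fh u false).
apply: leq_trans (leq_imset_card (fun e : E => (val e).2) _).
apply/subset_leq_card/subsetP => w; rewrite inE => owu.
have wu := o_adj _ _ owu; have uw : adj u w by rewrite adj_sym.
apply/imsetP; exists (exist _ (u, w) uw) => //.
by rewrite !inE /h /= eqxx -oE /= o_asym // owu.
Qed.

(** * Edge sets of walks and paths *)

Section Walks.
Variable H : sgraph.
Implicit Types (a b : H) (p : seq H) (F : {set {set H}}).

Lemma walk_edges_cons a b p :
  walk_edges a (b :: p) = [set a; b] |: walk_edges b p.
Proof.
apply/setP => e; rewrite !inE; apply/imsetP/orP => [[z]|[/eqP ->|/imsetP[z zP ->]]].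
- rewrite inE => /orP[/eqP -> -> |zP ->]; first by left.
  by right; apply/imsetP; exists z.
- by exists (a, b); rewrite ?inE ?eqxx.
by exists z; rewrite // inE zP orbT.
Qed.

Lemma walk_edges_rcons a p b :
  walk_edges a (rcons p b) = [set last a p; b] |: walk_edges a p.
Proof.
elim: p a => [|c p IHp] a; first by rewrite /= walk_edges_cons.
by rewrite rcons_cons !walk_edges_cons IHp setUCA.
Qed.

Lemma walk_edges_rev a p :
  walk_edges (last a p) (rev (belast a p)) = walk_edges a p.
Proof.
elim: p a => // b p IHp a; rewrite /= rev_cons walk_edges_rcons IHp walk_edges_cons.
congr (_ |: _); rewrite setUC; congr [set _; _].
by case: p {IHp} => //= c p; rewrite rev_cons last_rcons.
Qed.

Lemma path_edge_set_sym a b F : path_edge_set a b F -> path_edge_set b a F.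
Proof.
case=> p [pth <- unq ->]; exists (rev (belast a p)).
have E : rev (a :: p) = last a p :: rev (belast a p) by rewrite lastI rev_rcons.
split.
- rewrite rev_path; apply: sub_path pth => x y; by rewrite adj_sym.
- by case: p {pth unq E} => //= c p; rewrite rev_cons last_rcons.
- by rewrite -E rev_uniq.
by rewrite walk_edges_rev.
Qed.

Lemma connect_path_edge_set F a b :
    connect (fun x y => adj x y && ([set x; y] \in F)) a b ->
  exists2 R, path_edge_set a b R & R \subset F.
Proof.
case/connectP => p /shortenP[q pth unq _] ->.
exists (walk_edges a q).
  by exists q; split=> //; apply: sub_path pth => x y /andP[].
elim: q a pth {unq} => [|c q IHq] a; last first.
  move=> /= /andP[/andP[_ acF] /IHq]; rewrite walk_edges_cons subUset => ->.
  by rewrite sub1set acF.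
by move=> _; apply/subsetP => e /imsetP[z].
Qed.
End Walks.

Lemma card_bigcup_le (I T : finType) (A : I -> {set T}) :
  #|\bigcup_i A i| <= \sum_i #|A i|.
Proof.
apply: (big_ind2 (fun (B : {set T}) n => #|B| <= n)); rewrite ?cards0 //.
by move=> B m C n Bm Cn; rewrite (leq_trans (leq_card_setU B C)) ?leq_add.
Qed.

Lemma card_preim_le (E Y : finType) (f : E -> Y) (B : {set Y}) k :
    (forall y, #|f @^-1: [set y]| <= k) ->
  #|f @^-1: B| <= k * #|B|.
Proof.
move=> f_le; rewrite -sum1_card (partition_big f (mem B)) /=; last first.
  by move=> e; rewrite inE.
rewrite mulnC -sum_nat_const; apply: leq_sum => y yB.
rewrite sum1_card (leq_trans _ (f_le y)) // subset_leq_card //.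
by apply/subsetP => e; rewrite !inE unfold_in /= => /andP[].
Qed.

(** * Packet routing on the grid *)

Section Routing.
Variables (d : nat) (l : 'I_d -> nat) (hl : forall i, 0 < l i).
Implicit Types (i j : 'I_d) (z a b : grid_node l).

(* Reducing [n] modulo [l i] makes [upd] total; as a result [line i z] also
   contains the wrap-around pair, which need not be an edge of the grid. *)
Definition upd i z n : grid_node l :=
  finfun (fun j => if j == i then Ordinal (ltn_pmod n (hl j)) else z j).

Lemma updE i z n j :
  upd i z n j = if j == i then Ordinal (ltn_pmod n (hl j)) else z j.
Proof. by rewrite ffunE. Qed.

Lemma upd_upd i z m n : upd i (upd i z m) n = upd i z n.
Proof. by apply/ffunP => j; rewrite !updE; case: eqP. Qed.

Lemma upd_id i z : upd i z (z i) = z.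
Proof.
apply/ffunP => j; rewrite updE; case: eqP => // ->.
by apply: val_inj; rewrite /= modn_small.
Qed.

Lemma upd_mod i z n : upd i z (n %% l i) = upd i z n.
Proof.
apply/ffunP => j; rewrite !updE; case: eqP => // ->.
by apply: val_inj; rewrite /= modn_mod.
Qed.

Definition line i z : {set {set grid l}} :=
  [set [set upd i z t; upd i z t.+1] | t : 'I_(l i)].

Lemma card_line i z : #|line i z| <= l i.
Proof. by rewrite (leq_trans (leq_imset_card _ _)) // card_ord. Qed.

(** Here [upd i b 0] serves as the name of the line through [b] in direction [i]. *)
Lemma card_line_nodes i z : #|[set b | upd i b 0 == z]| <= l i.
Proof.
rewrite -[X in _ <= X]card_ord -cardsT.
apply: leq_trans (leq_imset_card (fun t : 'I_(l i) => upd i z t) _).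
apply/subset_leq_card/subsetP => b; rewrite inE => /eqP <-.
by apply/imsetP; exists (b i); rewrite // upd_upd upd_id.
Qed.

(** The direction is the coordinate in which the two ends differ, and resetting it in either end
    names the line. *)
Lemma mem_line (e : {set grid l}) : e \in edges (grid l) ->
  exists i0 (a : grid_node l), forall i z,
    e \in line i z -> i = i0 /\ upd i0 z 0 = a.
Proof.
case/imsetP => -[p q]; rewrite inE /= => /existsP[i0 /andP[pq _]] ->.
exists i0, (upd i0 p 0) => i z /imsetP[t _ Et].
have [m Ep] : exists m, p = upd i z m.
  by have := set21 p q; rewrite Et !inE => /orP[]/eqP; [exists t | exists t.+1].
have [n Eq] : exists n, q = upd i z n.
  by have := set22 p q; rewrite Et !inE => /orP[]/eqP; [exists t | exists t.+1].
have Ei : i = i0.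
  by apply: contraTeq pq; rewrite eq_sym Ep Eq !updE => /negbTE ->; rewrite orbb gtn_eqF.
by rewrite Ep Ei upd_upd.
Qed.

Section Connect.
Variable F : {set {set grid l}}.
Let r (a b : grid l) := adj a b && ([set a; b] \in F).

Lemma route_connect_sym : connect_sym r.
Proof. by apply: sym_connect_sym => a b; rewrite /r adj_sym setUC. Qed.

Lemma line_connect i z n : line i z \subset F -> connect r z (upd i z n).
Proof.
move=> /subsetP zF.
have c0 t : t < l i -> connect r (upd i z 0) (upd i z t).
  elim: t => // t IHt lt_t; apply: connect_trans (IHt (ltnW lt_t)) (connect1 _).
  apply/andP; split; last by apply/zF/imsetP; exists (Ordinal (ltnW lt_t)).
  apply/existsP; exists i; rewrite !updE eqxx /= !modn_small ?(ltnW lt_t) // eqxx.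
  by apply/forallP => j; apply/implyP => /negbTE Nj; rewrite !updE Nj.
rewrite -{1}(upd_id i z) -[X in connect _ _ X]upd_mod; apply: (@connect_trans _ _ (upd i z 0)).
  by rewrite route_connect_sym c0.
by rewrite c0 // ltn_mod.
Qed.
End Connect.

(** With [a] the intermediate node, this is the position of a packet from [b] after [n] coordinate
    changes. *)
Definition mix n a b : grid_node l :=
  finfun (fun j : 'I_d => if j < n then a j else b j).

Lemma mixE n a b j : mix n a b j = if j < n then a j else b j.
Proof. by rewrite ffunE. Qed.

Lemma mix0 a b : mix 0 a b = b.
Proof. by apply/ffunP => j; rewrite mixE. Qed.

Lemma mix_all a b : mix d a b = a.
Proof. by apply/ffunP => j; rewrite mixE ltn_ord. Qed.

Lemma mixS i a b : mix i.+1 a b = upd i (mix i a b) (a i).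
Proof.
apply/ffunP => j; rewrite updE !mixE ltnS leq_eqVlt; case: (eqVneq j i) => [->|Nj].
  by apply: val_inj; rewrite eqxx /= modn_small.
by rewrite (inj_eq val_inj) (negbTE Nj).
Qed.

(** Hence choosing coordinate [i] of the intermediate node leaves the positions of the earlier
    phases intact. *)
Lemma mix_upd n i a b m : n <= i -> mix n (upd i a m) b = mix n a b.
Proof.
move=> ni; apply/ffunP => j; rewrite !mixE updE.
by case: ifP => // jn; rewrite -(inj_eq val_inj) ltn_eqF // (leq_trans jn).
Qed.

Section Packets.
Variables (E : finType) (k : nat) (x y : E -> grid_node l).

Definition spread (f : E -> grid_node l) := forall a, #|f @^-1: [set a]| <= k.

Lemma spread_line i (f : E -> grid_node l) a :
  spread f -> #|[set e | upd i (f e) 0 == a]| <= k * l i.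
Proof.
move=> fk; have -> : [set e | upd i (f e) 0 == a] =
    f @^-1: [set b | upd i b 0 == a] by apply/setP => e; rewrite !inE.
apply: leq_trans (card_preim_le _ fk) _.
by rewrite leq_mul2l card_line_nodes orbT.
Qed.

Hypotheses (x_spread : spread x) (y_spread : spread y).

Lemma intermediate : exists c : E -> grid_node l, forall n, n <= d ->
  spread (fun e => mix n (c e) (x e)) /\ spread (fun e => mix n (c e) (y e)).
Proof.
suff: forall m, m <= d -> exists c : E -> grid_node l, forall n, n <= m ->
  spread (fun e => mix n (c e) (x e)) /\ spread (fun e => mix n (c e) (y e)).
  by apply.
elim=> [_|m IHm lt_m].
  exists x => n; rewrite leqn0 => /eqP ->; split=> a.
    by rewrite (eq_card (B := x @^-1: [set a])) // => e; rewrite !inE mix0.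
  by rewrite (eq_card (B := y @^-1: [set a])) // => e; rewrite !inE mix0.
have [c c_spread] := IHm (ltnW lt_m); pose i := Ordinal lt_m.
have [cx cy] := c_spread m (leqnn m).
(* The vertices of the multigraph: the line on which a packet sits when coordinate [m] is about to
   change. *)
pose g (q : E -> grid_node l) e := upd i (mix m (c e) (q e)) 0.
have g_le q : spread (fun e => mix m (c e) (q e)) ->
    forall a, #|g q @^-1: [set a]| <= k * l i.
  move=> qk a; apply: leq_trans (spread_line i a qk).
  by apply/subset_leq_card/subsetP => e; rewrite !inE.
have [col [colx coly]] := bipartite_colouring (hl i) (g_le _ cx) (g_le _ cy).
exists (fun e => upd i (c e) (col e)) => n; rewrite leq_eqVlt => /orP[/eqP ->|].
  (* The colour becomes coordinate [m], so packets meeting at [a] share both a line and a colour. *)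
  have step q a : (forall b (j : 'I_(l i)), #|[set e | (g q e == b) && (col e == j)]| <= k) ->
      #|(fun e => mix m.+1 (upd i (c e) (col e)) (q e)) @^-1: [set a]| <= k.
    move=> qk; apply: leq_trans (qk (upd i a 0) (a i)).
    apply/subset_leq_card/subsetP => e; rewrite !inE => /eqP <-.
    rewrite (mixS i) mix_upd // upd_upd eqxx updE eqxx; apply/eqP/val_inj.
    by rewrite updE eqxx /= modn_mod modn_small.
  by split=> a; apply: step.
rewrite ltnS => nm; have [nx ny] := c_spread n nm; split=> a.
  apply: leq_trans (nx a).
  by apply/subset_leq_card/subsetP => e; rewrite !inE mix_upd.
apply: leq_trans (ny a).
by apply/subset_leq_card/subsetP => e; rewrite !inE mix_upd.
Qed.

Lemma grid_routing : exists F : E -> {set {set grid l}},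
  [/\ forall e, connect (fun p q : grid l => adj p q && ([set p; q] \in F e))
        (x e) (y e),
      forall e, #|F e| <= 2 * \sum_i l i &
      forall e', e' \in edges (grid l) ->
        #|[set e | e' \in F e]| <= 2 * k * \max_i l i].
Proof.
have [c c_spread] := intermediate.
(* Whole lines are taken rather than the segments travelled; two lines per direction already meet
   the length bound. *)
pose F e := \bigcup_i (line i (mix i (c e) (x e)) :|: line i (mix i (c e) (y e))).
exists F; split=> [e|e|e' /mem_line[i0 [a Ha]]].
- pose r := fun p q : grid l => adj p q && ([set p; q] \in F e).
  have step z : (forall i, line i (mix i (c e) z) \subset F e) -> connect r z (c e).
    move=> zF; suff H n : n <= d -> connect r z (mix n (c e) z).
      by rewrite -[X in connect _ _ X](mix_all (c e) z) H.
    elim: n => [|n IHn] lt_n; first by rewrite mix0 connect0.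
    apply: connect_trans (IHn (ltnW lt_n)) _; rewrite (mixS (Ordinal lt_n)).
    exact/line_connect/(zF (Ordinal lt_n)).
  apply: (@connect_trans _ _ (c e)); last rewrite route_connect_sym;
    apply: step => i; apply: subset_trans (bigcup_sup i _) => //.
    exact: subsetUl.
  exact: subsetUr.
- apply: leq_trans (card_bigcup_le _) _; rewrite big_distrr /=.
  apply: leq_sum => i _; rewrite mul2n -addnn.
  by rewrite (leq_trans (leq_card_setU _ _)) // leq_add ?card_line.
(* A packet with [e'] in [F e] is on the line named [a] in phase [i0], on the [x]-side or on the
   [y]-side. *)
pose P q := [set e | upd i0 (mix i0 (c e) (q e)) 0 == a].
have [cx cy] := c_spread i0 (ltnW (ltn_ord i0)).
apply: (@leq_trans #|P x :|: P y|).
  apply/subset_leq_card/subsetP => e; rewrite !inE => /bigcupP[i _].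
  rewrite inE => /orP[]/[dup]/Ha[-> <-] _; rewrite eqxx ?orbT //.
apply: leq_trans (leq_card_setU _ _) _; rewrite -mulnA mul2n -addnn leq_add //.
  apply: leq_trans (spread_line i0 a cx) _.
  by rewrite leq_mul2l leq_bigmax orbT.
apply: leq_trans (spread_line i0 a cy) _.
by rewrite leq_mul2l leq_bigmax orbT.
Qed.
End Packets.
End Routing.

(** * Assembling the embedding *)

Theorem theorem1 (G : sgraph) (N Delta d : nat) (l : 'I_d -> nat)
    (hN : #|G| = N) (hDelta : max_degree G = Delta)
    (hd : 0 < d) (hl : forall i : 'I_d, 0 < l i)
    (hprod : N <= \prod_(i < d) l i) :
  exists f : embedding G (grid l),
    dilation f <= 2 * \sum_(i < d) l i /\
    edge_congestion f <= 2 * uphalf Delta * \max_(i < d) l i.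
Proof.
have [phi phiI] : exists phi : G -> grid l, injective phi.
  have card_le : #|G| <= #|grid l|.
    rewrite hN (leq_trans hprod) // card_dep_ffun foldrE big_map big_enum /=.
    by under [leqRHS]eq_bigr do rewrite card_ord.
  exists (fun u => enum_val (widen_ord card_le (enum_rank u))) => u v.
  by move=> /enum_val_inj/(congr1 val)/= /val_inj/enum_rank_inj.
have [o [o_asym o_adj o_out o_in]] := balanced_orientation G.
pose E := {p : G * G | o p.1 p.2}.
pose x (e : E) := phi (val e).1; pose y (e : E) := phi (val e).2.
(* As [phi] is injective, the packets starting at [a] are the arcs leaving a single node of [G]. *)
have x_spread : spread (uphalf Delta) x.
  move=> a; have [->|/set0Pn[e0]] := eqVneq (x @^-1: [set a]) set0.
    by rewrite cards0.
  rewrite !inE => /eqP Ea; rewrite -hDelta (leq_trans _ (o_out (val e0).1)) //.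
  rewrite -(card_in_imset (f := fun e : E => (val e).2)); last first.
    move=> e1 e2; rewrite !inE => /eqP E1 /eqP E2 E3; apply: val_inj.
    by apply/eqP; rewrite -pair_eqE /= E3 eqxx andbT -(inj_eq phiI) -/(x e1) E1 -E2.
  apply/subset_leq_card/subsetP => w /imsetP[e]; rewrite !inE -Ea.
  by move=> /eqP/phiI <- ->; exact: (valP e).
have y_spread : spread (uphalf Delta) y.
  move=> a; have [->|/set0Pn[e0]] := eqVneq (y @^-1: [set a]) set0.
    by rewrite cards0.
  rewrite !inE => /eqP Ea; rewrite -hDelta (leq_trans _ (o_in (val e0).2)) //.
  rewrite -(card_in_imset (f := fun e : E => (val e).1)); last first.
    move=> e1 e2; rewrite !inE => /eqP E1 /eqP E2 E3; apply: val_inj.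
    by apply/eqP; rewrite -pair_eqE /= E3 eqxx andTb -(inj_eq phiI) -/(y e1) E1 -E2 eqxx.
  apply/subset_leq_card/subsetP => w /imsetP[e]; rewrite !inE -Ea.
  by move=> /eqP/phiI <- ->; exact: (valP e).
have [F [F_conn F_card F_cong]] := grid_routing hl x_spread y_spread.
pose ends (e : E) := [set (val e).1; (val e).2].
(* Only one direction of each edge is an arc, so an edge determines its packet. *)
have endsI : injective ends.
  move=> [[u v] uv] [[u' v'] uv'] Ee; apply: val_inj => /=; move: uv uv' Ee.
  rewrite /ends /= => uv uv' Ee.
  have := set21 u v; have := set22 u v; rewrite Ee !inE.
  move=> /orP[]/eqP Ev /orP[]/eqP Eu; rewrite Eu Ev //; move: uv uv'; rewrite Eu Ev.
  - by move=> /o_adj; rewrite adj_irr.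
  - by move=> vu /[dup]/o_adj/o_asym ->; rewrite vu.
  by move=> /o_adj; rewrite adj_irr.
have endsP u v : adj u v -> exists2 e, [set u; v] = ends e &
    (val e = (u, v)) \/ (val e = (v, u)).
  move=> uv; case ouv : (o u v).
    by exists (exist _ (u, v) ouv) => //; left.
  have ovu : o v u by move: (o_asym _ _ uv); rewrite ouv => /esym/negbFE.
  by exists (exist _ (v, u) ovu); [rewrite /ends /= setUC | right].
(* Routes are chosen per unordered pair; sets that are not edges get the dummy value [set0]. *)
have /fin_all_exists[R HR] : forall S : {set G}, exists R : {set {set grid l}},
    forall e, S = ends e -> path_edge_set (x e) (y e) R /\ R \subset F e.
  move=> S; have [/existsP[e /eqP ->]|/existsPn NS] :=
    boolP [exists e, S == ends e].
    have [R pR RF] := connect_path_edge_set (F_conn e).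
    by exists R => e' /endsI <-.
  by exists set0 => e /eqP; rewrite (negbTE (NS e)).
have route_path u v : adj u v -> path_edge_set (phi u) (phi v) (R [set u; v]).
  case/endsP => e /HR[pR _] Ee; case: Ee pR; rewrite /x /y => -> //.
  exact: path_edge_set_sym.
have edges_ends S : S \in edges G -> exists e, S = ends e.
  by case/imsetP => -[u v]; rewrite inE => /endsP[e Ee _] ->; exists e.
exists (Embedding phiI route_path); split.
  apply/bigmax_leqP => S /edges_ends[e /[dup]/HR[_ RF] _] /=.
  by rewrite (leq_trans (subset_leq_card RF)).
apply/bigmax_leqP => e' /F_cong; apply: leq_trans => /=.
apply: leq_trans (leq_imset_card ends _).
apply/subset_leq_card/subsetP => S; rewrite inE => /andP[/edges_ends[e Ee] Re].
apply/imsetP; exists e => //; rewrite inE.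
by have [_ /subsetP ->] := HR _ _ Ee.
Qed.
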